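(* Let the cell partition $\mathbb{T}$ be restricted to star-shaped, geometrically admissible polyhedral elements for which positive two-point transmissibility weights are structurally guaranteed. Suppose the local cell-wise flux inner product matrices satisfy, for every cell $\mathcal{C}\in\mathbb{T}$ and all local flux test vectors $\mathbf{v}_\mathcal{C}$ (one entry per face of $\mathcal{C}$), $$\alpha_{\min}\mathbf{v}_\mathcal{C}^T\mathbf{v}_\mathcal{C}\le\mathbf{v}_\mathcal{C}^TM^{\mathrm{MFD}}_\mathcal{C}\mathbf{v}_\mathcal{C}\le\alpha_{\max}\mathbf{v}_\mathcal{C}^T\mathbf{v}_\mathcal{C},\qquad \beta_{\min}\mathbf{v}_\mathcal{C}^T\mathbf{v}_\mathcal{C}\le\mathbf{v}_\mathcal{C}^TM^{\mathrm{TPFA}}_\mathcal{C}\mathbf{v}_\mathcal{C}\le\beta_{\max}\mathbf{v}_\mathcal{C}^T\mathbf{v}_\mathcal{C},$$ where $\alpha_{\min},\beta_{\min}>0$. Then, for any arbitrary cell partition layout (assignment of TPFA or MFD to the cells) determined by the tolerance parameter $\tau$, the globally assembled hybrid inner product matrix $M^\tau$ satisfies $$\mu_{\min}\mathbf{v}^T\mathbf{v}\le\mathbf{v}^TM^\tau\mathbf{v}\le\mu_{\max}\mathbf{v}^T\mathbf{v}\qquad\forall\,\mathbf{v}\in\mathbb{R}^{|\mathbb{F}|},$$ where $\mu_{\min}=\min(\alpha_{\min},\beta_{\min})>0$ and $\mu_{\max}=2\max(\alpha_{\max},\beta_{\max})$ are constants independent of $\tau$.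
   Context: $\mathbb{T}$ is a finite partition of a domain into polyhedral cells and $\mathbb{F}$ is its set of faces; every interior face is shared by exactly two cells and every boundary face belongs to one cell. For $\mathbf{v}\in\mathbb{R}^{|\mathbb{F}|}$ (one value per face), $\mathbf{v}_\mathcal{C}$ denotes its restriction to the faces of $\mathcal{C}$. Each cell carries two symmetric local matrices, $M^{\mathrm{TPFA}}_\mathcal{C}$ (two-point flux approximation) and $M^{\mathrm{MFD}}_\mathcal{C}$ (mimetic finite difference), of size the number of faces of $\mathcal{C}$. Given a tolerance $\tau>0$ and a cell-wise indicator value $\eta_\mathcal{C}$, put $\chi_\mathcal{C}=0$ if $\eta_\mathcal{C}\le\tau$ and $\chi_\mathcal{C}=1$ if $\eta_\mathcal{C}>\tau$, and $M_\mathcal{C}=(1-\chi_\mathcal{C})M^{\mathrm{TPFA}}_\mathcal{C}+\chi_\mathcal{C}M^{\mathrm{MFD}}_\mathcal{C}$. The matrix $M^\tau$ is the assembled global matrix, characterized by $\mathbf{v}^TM^\tau\mathbf{v}=\sum_{\mathcal{C}\in\mathbb{T}}\mathbf{v}_\mathcal{C}^TM_\mathcal{C}\mathbf{v}_\mathcal{C}$ for all $\mathbf{v}\in\mathbb{R}^{|\mathbb{F}|}$. *)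

(* Defs.v *)
From HB Require Import structures.
From mathcomp Require Import all_boot all_order all_algebra.
From mathcomp Require Import all_classical all_reals all_analysis.

Set Implicit Arguments.
Unset Strict Implicit.
Unset Printing Implicit Defensive.

Import Order.TTheory GRing.Theory Num.Theory.
Import numFieldNormedType.Exports.

Local Open Scope classical_set_scope.
Local Open Scope ring_scope.

Section Geometry.
Context {R : realType} {d : nat}.
Local Notation E := 'rV[R]_d.+1.
Implicit Types (x y n : E) (A P F C : set E) (K : 'M[R]_d.+1).

Definition dot x y : R := (x *m y^T) 0 0.

Definition convex_polytope P : Prop :=
  bounded_set P /\
  exists (k : nat) (n : 'I_k -> E) (b : 'I_k -> R),
    P = [set x | forall i, dot (n i) x <= b i].

(* Polyhedra need not be convex. *)
Definition polyhedral P : Prop :=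
  exists (k : nat) (Q : 'I_k -> set E),
    (forall i, convex_polytope (Q i)) /\ P = \bigcup_i Q i.

Definition boundary A : set E := closure A `\` A°.

Definition star_shaped C : Prop :=
  exists2 z, C z & forall y (t : R), C y -> 0 <= t <= 1 ->
    C ((1 - t) *: z + t *: y).

Definition unit_normal F n : Prop :=
  dot n n = 1 /\ forall x y, F x -> F y -> dot n (x - y) = 0.

(* Interior of F relative to the hyperplane orthogonal to n, for F contained
   in such a hyperplane. *)
Definition relint n F : set E :=
  [set x | F x /\ exists2 e : R, 0 < e &
     forall y, dot n (y - x) = 0 -> `|y - x| < e -> F y].

Definition outward_normal C F n : Prop :=
  unit_normal F n /\
  forall x, relint n F x -> exists2 e : R, 0 < e &
    forall t : R, 0 < t < e -> C (x - t *: n) /\ ~ C° (x + t *: n).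

Definition sym_posdef K : Prop :=
  K^T = K /\ forall x, x != 0 -> 0 < dot (x *m K) x.

End Geometry.

Record polyhedral_mesh (R : realType) (d : nat) := PolyhedralMesh {
  domain : set 'rV[R]_d.+1;
  cell : finType;
  face : finType;
  cell_set : cell -> set 'rV[R]_d.+1;
  face_set : face -> set 'rV[R]_d.+1;
  faces : cell -> {set face};
  domain_open : open domain;
  domain_connected : connected domain;
  domain_nonempty : domain !=set0;
  cell_polyhedral : forall c, polyhedral (cell_set c);
  cell_interior : forall c, (cell_set c)° !=set0;
  cell_regular : forall c, cell_set c = closure (cell_set c)°;
  cells_cover : closure domain = \bigcup_c cell_set c;
  cells_disjoint : forall c c', c != c' ->
    (cell_set c)° `&` (cell_set c')° = set0;
  face_polyhedral : forall f, polyhedral (face_set f);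
  (* a face is planar and purely of codimension one *)
  face_planar : forall f, exists n, [/\ unit_normal (face_set f) n,
    relint n (face_set f) !=set0 &
    face_set f = closure (relint n (face_set f))];
  cell_boundary : forall c,
    boundary (cell_set c) = \bigcup_(f in [set` faces c]) face_set f;
  faces_disjoint : forall c f f' n n', f \in faces c -> f' \in faces c ->
    f != f' -> unit_normal (face_set f) n -> unit_normal (face_set f') n' ->
    relint n (face_set f) `&` relint n' (face_set f') = set0;
  boundary_face : forall f, face_set f `<=` boundary domain ->
    #|[set c | f \in faces c]%SET| = 1%N;
  interior_face : forall f, ~ face_set f `<=` boundary domain ->
    #|[set c | f \in faces c]%SET| = 2%N
}.

(* The d-dimensional measure of a face enters only as a positive factor of the
   transmissibilities, and is kept as a parameter. *)
Record tpfa_data (R : realType) (d : nat) (T : polyhedral_mesh R d) :=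
  TpfaData {
  cell_center : cell T -> 'rV[R]_d.+1;
  face_center : face T -> 'rV[R]_d.+1;
  face_measure : face T -> R;
  permeability : cell T -> 'M[R]_d.+1;
  face_center_plane : forall f n x, unit_normal (face_set f) n ->
    face_set f x -> dot n (face_center f - x) = 0;
  face_measure_gt0 : forall f, 0 < face_measure f;
  permeability_spd : forall c, sym_posdef (permeability c)
}.

Section Hybrid.
Context {R : realType} {d : nat} {T : polyhedral_mesh R d}.

(* |F| (n . K (x_F - x_C)) / |x_F - x_C|^2, with n the unit normal of F
   pointing out of C. *)
Definition transmissibility (G : tpfa_data T) (c : cell T) (f : face T)
    (n : 'rV[R]_d.+1) : R :=
  let r := face_center G f - cell_center G c in
  face_measure G f * dot (n *m permeability G c) r / dot r r.

Definition admissible_cell (G : tpfa_data T) (c : cell T) : Prop :=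
  forall f, f \in faces c ->
    exists2 n, outward_normal (cell_set c) (face_set f) n
             & 0 < transmissibility G c f n.

(* Global vectors are indexed by the enumeration of all faces, local ones by
   the enumeration of the faces of a cell. *)
Definition face_vector := 'cV[R]_#|face T|.
Definition local_vector (c : cell T) := 'cV[R]_#|faces c|.
Definition local_matrix (c : cell T) := 'M[R]_#|faces c|.

Definition restr (c : cell T) (v : face_vector) : local_vector c :=
  \col_i v (enum_rank (enum_val i)) 0.

Definition restr_mx (c : cell T) : 'M[R]_(#|faces c|, #|face T|) :=
  \matrix_(i, j) (enum_val i == enum_val j)%:R.

Definition sqnorm m (v : 'cV[R]_m) : R := (v^T *m v) 0 0.

Definition quad m (A : 'M[R]_m) (v : 'cV[R]_m) : R := (v^T *m A *m v) 0 0.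

Definition assemble (M : forall c : cell T, local_matrix c) : 'M[R]_#|face T| :=
  \sum_c (restr_mx c)^T *m M c *m restr_mx c.

Definition switch (eta : cell T -> R) (tau : R) (c : cell T) : R :=
  if eta c <= tau then 0 else 1.

Definition hybrid_local (MTPFA MMFD : forall c : cell T, local_matrix c)
    (eta : cell T -> R) (tau : R) (c : cell T) : local_matrix c :=
  (1 - switch eta tau c) *: MTPFA c + switch eta tau c *: MMFD c.

Definition hybrid_matrix (MTPFA MMFD : forall c : cell T, local_matrix c)
    (eta : cell T -> R) (tau : R) : 'M[R]_#|face T| :=
  assemble (hybrid_local MTPFA MMFD eta tau).

Lemma restr_mxE (c : cell T) (v : face_vector) : restr_mx c *m v = restr c v.
Proof.
apply/matrixP => i j; rewrite !mxE ord1 (bigD1 (enum_rank (enum_val i))) //=.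
rewrite !mxE enum_rankK eqxx mul1r big1 ?addr0 // => k kP.
rewrite mxE; case: eqP => [E|]; last by rewrite mul0r.
by move: kP; rewrite E enum_valK eqxx.
Qed.

(* The next three lemmas characterize the assembled matrix as the symmetric
   matrix whose quadratic form is the sum of the local ones. *)
Lemma quad_assemble (M : forall c : cell T, local_matrix c) (v : face_vector) :
  quad (assemble M) v = \sum_c quad (M c) (restr c v).
Proof.
rewrite /quad /assemble mulmx_sumr mulmx_suml summxE; apply: eq_bigr => c _.
by rewrite -restr_mxE trmx_mul !mulmxA.
Qed.

Lemma trmx_assemble (M : forall c : cell T, local_matrix c) :
  (forall c, (M c)^T = M c) -> (assemble M)^T = assemble M.
Proof.
move=> MT; rewrite /assemble linear_sum; apply: eq_bigr => c _ /=.
by rewrite !trmx_mul trmxK MT mulmxA.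
Qed.

Lemma quad_inj m (A B : 'M[R]_m) : A^T = A -> B^T = B ->
  (forall v, quad A v = quad B v) -> A = B.
Proof.
have quadD (D : 'M[R]_m) i j : D^T = D ->
    quad D (delta_mx i 0 + delta_mx j 0) =
    quad D (delta_mx i 0) + quad D (delta_mx j 0) + 2 * D i j.
  move=> DT; have e k l :
      ((delta_mx k (0 : 'I_1))^T *m D *m delta_mx l (0 : 'I_1)) 0 0 = D k l.
    by rewrite trmx_delta -rowE -colE !mxE.
  have addE (x y : 'M[R]_1) : (x + y) 0 0 = x 0 0 + y 0 0 by rewrite mxE.
  rewrite /quad [(_ + _)^T]linearD /= !mulmxDl !mulmxDr !addE !e.
  have -> : D j i = D i j by rewrite -{1}DT mxE.
  by rewrite mulr2n mulrDl mul1r !addrA addrAC [_ + D i j + D j j]addrAC.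
move=> AT BT AB; apply/matrixP => i j.
have := AB (delta_mx i 0 + delta_mx j 0).
rewrite !quadD // !AB => /addrI /mulfI; apply.
by rewrite pnatr_eq0.
Qed.

End Hybrid.

Arguments face_vector {R d} T.

(* Main.v *)
(* Each face lies in one or two cells, so the local squared norms of the
   restrictions of v add up to at least the squared norm of v and to at most
   twice it; each hybrid local form is one of the two given forms. *)
Require Import Defs.
From mathcomp Require Import all_boot all_order all_algebra.
From mathcomp Require Import all_classical all_reals all_analysis.

Import Order.TTheory GRing.Theory Num.Theory.
Import numFieldNormedType.Exports.

Local Open Scope ring_scope.

Section FaceCounting.
Context {R : realType} {d : nat} {T : polyhedral_mesh R d}.
Implicit Types (v : face_vector T) (f : face T) (c : cell T).

Lemma sqnormE m (w : 'cV[R]_m) : sqnorm w = \sum_i w i 0 ^+ 2.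
Proof. by rewrite /sqnorm mxE; apply: eq_bigr => i _; rewrite !mxE expr2. Qed.

Lemma sqnorm_ge0 m (w : 'cV[R]_m) : 0 <= sqnorm w.
Proof. by rewrite sqnormE sumr_ge0 // => i _; rewrite sqr_ge0. Qed.

Definition multiplicity f : nat := #|[set c | f \in faces c]%SET|.

(** A face inside the boundary of the domain lies in one cell, any other face in two; these are the
    only cases. *)
Lemma multiplicity_bounds f : (1 <= multiplicity f <= 2)%N.
Proof.
rewrite /multiplicity.
have [bf|bf] := pselect (face_set f `<=` boundary (domain T))%classic.
  by rewrite boundary_face.
by rewrite interior_face.
Qed.

(** Summing over the faces themselves instead of their ranks makes the global norm comparable term
    by term with the local ones. *)
Lemma sqnorm_faces v : sqnorm v = \sum_f v (enum_rank f) 0 ^+ 2.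
Proof.
by rewrite sqnormE (reindex enum_rank) //=; apply/onW_bij/enum_rank_bij.
Qed.

Lemma sqnorm_restr c v :
  sqnorm (restr c v) = \sum_(f in faces c) v (enum_rank f) 0 ^+ 2.
Proof.
by rewrite sqnormE [RHS]big_enum_val; apply: eq_bigr => i _; rewrite mxE.
Qed.

(** Double counting: after the sums over cells and faces are exchanged, the square at [f] occurs
    once for each cell that has [f] as a face. *)
Lemma sum_sqnorm_restr v :
  \sum_c sqnorm (restr c v) =
  \sum_f v (enum_rank f) 0 ^+ 2 *+ multiplicity f.
Proof.
under eq_bigr do rewrite sqnorm_restr.
rewrite (exchange_big_dep predT) //=; apply: eq_bigr => f _.
by rewrite sumr_const /multiplicity cardsE.
Qed.

Lemma sum_sqnorm_restr_bounds v :
  sqnorm v <= \sum_c sqnorm (restr c v) <= 2 * sqnorm v.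
Proof.
rewrite sum_sqnorm_restr sqnorm_faces mulr_sumr.
apply/andP; split; apply: ler_sum => f _;
  have /andP[m1 m2] := multiplicity_bounds f.
  by rewrite -[leLHS]mulr1n ler_wpMn2l ?sqr_ge0.
by rewrite mulr_natl ler_wpMn2l ?sqr_ge0.
Qed.

(** Both local bounds are summed over the cells first; the sum of the local norms is then compared
    with [sqnorm v]. The factor 2 comes from faces shared by two cells, and the sign of [b] is left
    open. *)
Lemma assemble_bounds (M : forall c, local_matrix c) (a b : R) v : 0 <= a ->
  (forall c (w : local_vector c), a * sqnorm w <= quad (M c) w <= b * sqnorm w) ->
  a * sqnorm v <= quad (assemble M) v <= 2 * b * sqnorm v.
Proof.
move=> a0 Mab; have /andP[lo hi] := sum_sqnorm_restr_bounds v.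
have qlo : a * \sum_c sqnorm (restr c v) <= quad (assemble M) v.
  rewrite quad_assemble mulr_sumr; apply: ler_sum => c _.
  by case/andP: (Mab c (restr c v)).
have qhi : quad (assemble M) v <= b * \sum_c sqnorm (restr c v).
  rewrite quad_assemble mulr_sumr; apply: ler_sum => c _.
  by case/andP: (Mab c (restr c v)).
apply/andP; split; first by apply: le_trans qlo; rewrite ler_wpM2l.
(* A negative b is possible only when v vanishes. *)
have [b0|b0] := leP 0 b.
  by apply: le_trans qhi _; rewrite [2 * b]mulrC -mulrA ler_wpM2l.
(* The sum of the local norms, times [b], is at least [a] times that sum, hence nonnegative; as [b]
   is negative, the sum cannot be positive. *)
have S0 : \sum_c sqnorm (restr c v) <= 0.
  rewrite -(nmulr_rge0 _ b0); apply: le_trans (le_trans qlo qhi).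
  by rewrite mulr_ge0 // sumr_ge0 // => c _; apply: sqnorm_ge0.
have v0 : sqnorm v = 0.
  by apply/eqP; rewrite eq_le sqnorm_ge0 (le_trans lo S0).
have S0' : \sum_c sqnorm (restr c v) = 0.
  by apply/eqP; rewrite eq_le S0 -{1}v0.
by rewrite v0 mulr0; apply: le_trans qhi _; rewrite S0' mulr0.
Qed.

(** The switch takes only the values 0 and 1, so the combination always reduces to one of its two
    ends. *)
Lemma hybrid_local_or (MTPFA MMFD : forall c, local_matrix c)
    (eta : cell T -> R) (tau : R) c :
  hybrid_local MTPFA MMFD eta tau c = MTPFA c \/
  hybrid_local MTPFA MMFD eta tau c = MMFD c.
Proof.
rewrite /hybrid_local /switch; case: ifP => _.
  by left; rewrite subr0 scale1r scale0r addr0.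
by right; rewrite subrr scale0r scale1r add0r.
Qed.

End FaceCounting.

Theorem lemma3p2 (R : realType) (d : nat) (T : polyhedral_mesh R d)
    (G : tpfa_data T)
    (star_cells : forall c : cell T, star_shaped (cell_set c))
    (adm_cells : forall c : cell T, admissible_cell G c)
    (MTPFA MMFD : forall c : cell T, local_matrix c)
    (MTPFA_sym : forall c : cell T, (MTPFA c)^T = MTPFA c)
    (MMFD_sym : forall c : cell T, (MMFD c)^T = MMFD c)
    (alpha_min alpha_max beta_min beta_max : R)
    (alpha_min_gt0 : 0 < alpha_min) (beta_min_gt0 : 0 < beta_min)
    (MMFD_bounds : forall (c : cell T) (w : local_vector c),
       alpha_min * sqnorm w <= quad (MMFD c) w <= alpha_max * sqnorm w)
    (MTPFA_bounds : forall (c : cell T) (w : local_vector c),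
       beta_min * sqnorm w <= quad (MTPFA c) w <= beta_max * sqnorm w) :
  let mu_min := Num.min alpha_min beta_min in
  let mu_max := 2 * Num.max alpha_max beta_max in
  0 < mu_min /\
  forall (eta : cell T -> R) (tau : R), 0 < tau ->
  forall v : face_vector T,
    mu_min * sqnorm v <= quad (hybrid_matrix MTPFA MMFD eta tau) v
      <= mu_max * sqnorm v.
Proof.
move=> mu_min mu_max.
have mu_min_gt0 : 0 < mu_min by rewrite lt_min alpha_min_gt0.
split=> // eta tau _ v; apply: assemble_bounds => [|c w]; first exact: ltW.
have w0 := sqnorm_ge0 _ w.
(* Either choice obeys the bounds with the smaller lower and the larger upper constant, since
   [sqnorm w] is nonnegative; hence the constants do not depend on [tau]. *)
have [->|->] := hybrid_local_or MTPFA MMFD eta tau c.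
  have /andP[lo hi] := MTPFA_bounds c w; apply/andP; split.
    by apply: le_trans lo; rewrite ler_wpM2r // ge_min lexx orbT.
  by apply: le_trans hi _; rewrite ler_wpM2r // le_max lexx orbT.
have /andP[lo hi] := MMFD_bounds c w; apply/andP; split.
  by apply: le_trans lo; rewrite ler_wpM2r // ge_min lexx.
by apply: le_trans hi _; rewrite ler_wpM2r // le_max lexx.
Qed.
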